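(* Let $C\in W^{(l)}$ and $(\rho,\sigma)\in\mathfrak V$ with $\sigma\le0$. Suppose $v_{\rho,\sigma}(C)>0$ and $\ell_{\rho,\sigma}(C)\neq\zeta\,\ell_{\rho,\sigma}(D^h)$ for all $D\in W^{(l)}$, $\zeta\in K^\times$ and integers $h>1$. If there exist $n,m\in\mathbb{N}$ and $A,B\in W^{(l)}$ such that (1) $\ell_{\rho,\sigma}(A)=\ell_{\rho,\sigma}(C^n)$, (2) $\ell_{\rho,\sigma}(B)=\ell_{\rho,\sigma}(C^m)$, (3) $c:=\gcd(n,m)\notin\{n,m\}$, (4) $\ell_{\rho,\sigma}([A,B])=\lambda\,\ell_{\rho,\sigma}(C^h)$ for some $h\in\mathbb{N}_0$ and $\lambda\in K^\times$, then there exist $D\in W^{(l)}$, $\mu\in K^\times$ and $k,j_0\in\mathbb{N}$ such that $[D,C^k]_{\rho,\sigma}=\mu\,\ell_{\rho,\sigma}(C^{k+j_0})$.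
   Context: $K$ is a field of characteristic zero, $l\in\mathbb{N}$. $W^{(l)}$ is the associative $K$-algebra with $K$-basis $\{X^{i/l}Y^j:i\in\mathbb{Z},j\in\mathbb{N}_0\}$, powers of $X$ multiplying as Laurent monomials and $[Y,X^{\alpha}]=\alpha X^{\alpha-1}$ for $\alpha\in\frac1l\mathbb{Z}$. $L^{(l)}=K[x^{1/l},x^{-1/l},y]$, $\Psi^{(l)}(X^{i/l}Y^j)=x^{i/l}y^j$ ($K$-linear); $\mathrm{Supp}(P)$ = exponents of $\Psi^{(l)}(P)$ with nonzero coefficient. $\mathfrak V=\{(\rho,\sigma)\in\mathbb{Z}^2:\gcd(\rho,\sigma)=1,\rho+\sigma>0\}$. For $P\ne0$: $v_{\rho,\sigma}(P)=\max\{\rho a+\sigma b:(a,b)\in\mathrm{Supp}(P)\}$; $\ell_{\rho,\sigma}(P)\in L^{(l)}$ is the sum of the terms of $\Psi^{(l)}(P)$ of $(\rho,\sigma)$-degree $v_{\rho,\sigma}(P)$. $[P,Q]_{\rho,\sigma}:=0$ if $[P,Q]=0$ or $v_{\rho,\sigma}([P,Q])<v_{\rho,\sigma}(P)+v_{\rho,\sigma}(Q)-(\rho+\sigma)$, and $:=\ell_{\rho,\sigma}([P,Q])$ otherwise. *)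

(* Defs.v *)
From HB Require Import structures.
From mathcomp Require Import all_boot all_order all_algebra.
From mathcomp Require Import finmap.
Set Implicit Arguments. Unset Strict Implicit. Unset Printing Implicit Defensive.
Import Order.TTheory GRing.Theory Num.Theory.
Local Open Scope ring_scope.


(* Exponent pairs (i, j) stand for the monomial x^(i/l) y^j (resp. the basis
   element X^(i/l) Y^j of W^(l)). *)
Definition expo := (int * nat)%type.

(* Finitely supported coefficient families: elements of W^(l) are stored in
   the K-basis X^(i/l) Y^j, elements of L^(l) in the basis x^(i/l) y^j.
   Psi^(l) is therefore the identity on coefficient families. *)
Definition fam (K : fieldType) := {fsfun expo -> K with 0}.

Section W.
Variables (K : fieldType) (l : nat).

Definition fzero : fam K := [fsfun].
Definition fone : fam K := [fsfun e in [fset ((0%Z, 0%N) : expo)]%fset => (1 : K)].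
Definition fadd (P Q : fam K) : fam K :=
  [fsfun e in (finsupp P `|` finsupp Q)%fset => P e + Q e].
Definition fopp (P : fam K) : fam K := [fsfun e in finsupp P => - P e].
Definition fscale (z : K) (P : fam K) : fam K := [fsfun e in finsupp P => z * P e].

Definition ffall (a : K) (t : nat) : K := \prod_(s < t) (a - s%:R).

(* X^(i/l) Y^j * X^(i'/l) Y^k
     = sum_t binom(j,t) (i'/l)_t X^((i+i'-t l)/l) Y^(j+k-t),
   coming from Y^j X^a = sum_t binom(j,t) (a)_t X^(a-t) Y^(j-t),
   which follows from [Y, X^a] = a X^(a-1). *)
Definition mon_target (p q : expo) (t : nat) : expo :=
  ((p.1 + q.1 - (t * l)%:Z)%R, (p.2 + q.2 - t)%N).
Definition mon_coef (p q : expo) (t : nat) : K :=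
  ('C(p.2, t))%:R * ffall (q.1%:~R / l%:R) t.

Definition wmul_targets (P Q : fam K) : seq expo :=
  flatten [seq flatten [seq [seq mon_target p q t | t <- iota 0 p.2.+1]
                       | q <- finsupp Q] | p <- finsupp P].

Definition wmul (P Q : fam K) : fam K :=
  [fsfun e in [fset x in wmul_targets P Q]%fset =>
     \sum_(p <- finsupp P) \sum_(q <- finsupp Q) \sum_(t < p.2.+1)
        (if mon_target p q t == e then P p * Q q * mon_coef p q t else 0)].

Definition wexp (P : fam K) (n : nat) : fam K := iter n (wmul P) fone.

Definition wcomm (P Q : fam K) : fam K := fadd (wmul P Q) (fopp (wmul Q P)).

Variables (rho sigma : int).

Definition vdeg (e : expo) : rat :=
  rho%:~R * (e.1%:~R / l%:R) + sigma%:~R * (e.2)%:R.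

(* v_{rho,sigma}(P) (meaningful for P <> 0) *)
Definition vval (P : fam K) : rat :=
  \big[Num.max/vdeg (head (0%Z, 0%N) (finsupp P))]_(p <- finsupp P) vdeg p.

(* leading form l_{rho,sigma}(P), an element of L^(l) *)
Definition lead (P : fam K) : fam K :=
  [fsfun e in finsupp P => if vdeg e == vval P then P e else 0].

Definition brk (P Q : fam K) : fam K :=
  let c := wcomm P Q in
  if c == fzero then fzero
  else if vval c < vval P + vval Q - (rho + sigma)%:~R then fzero
  else lead c.

End W.

Definition in_frakV (rho sigma : int) : Prop :=
  gcdz rho sigma = 1%N /\ (0 < rho + sigma)%R.

(* Main.v *)
Require Import Defs.
From HB Require Import structures.
From mathcomp Require Import all_boot all_order all_algebra.
From mathcomp Require Import finmap.
From mathcomp Require Import zify ring.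
Import Order.TTheory GRing.Theory Num.Theory.
Local Open Scope ring_scope.
Set Implicit Arguments. Unset Strict Implicit. Unset Printing Implicit Defensive.

(* Since rho > 0, a (rho, sigma)-homogeneous form is determined by its degree
   and by the polynomial in y obtained by putting x = 1; on these polynomials
   leading forms of products multiply, and leading forms of commutators are
   given by a weighted Wronskian.  Consider R with l([A, R]) = lam l(C)^h,
   starting from R = B.  If l(R) Poisson-commutes with l(A), the Wronskian
   vanishes, so l(R)^a = z l(A)^b with a = l v(A), b = l v(R) (multiply R by a power
   of A first to make v(R) positive).  Then R' = (R^a - z A^b) R satisfies the
   same condition with another h, but v(A) + v(R') - (rho + sigma) - v([A, R'])
   is strictly smaller.  As this quantity is a nonnegative element of (1/l) Z,
   the descent stops at some R with [A, R]_(rho, sigma) proportional to a power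
   of l(C); then D = R A^2 and k = n work. *)

(** * Linear extension from basis monomials to families *)

Section LinearExtension.
Variable K : fieldType.
Implicit Types (P Q : fam K) (V : lmodType K).

Definition lin V (F : expo -> V) P : V := \sum_(e <- finsupp P) P e *: F e.

Lemma lin_widen V (F : expo -> V) P (S : {fset expo}) :
  (finsupp P `<=` S)%fset -> lin F P = \sum_(e <- S) P e *: F e.
Proof.
move=> sPS; rewrite /lin (big_fset_incl _ sPS) // => e _ eP.
by rewrite fsfun_dflt // scale0r.
Qed.

Lemma eq_lin V (F G : expo -> V) P :
  (forall e, e \in finsupp P -> F e = G e) -> lin F P = lin G P.
Proof. by move=> eqFG; apply: eq_big_seq => e /eqFG ->. Qed.

Lemma lin0 V P : lin (fun=> 0 : V) P = 0.
Proof. by rewrite /lin big1 // => e _; rewrite scaler0. Qed.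

Lemma linB V (F G : expo -> V) P : lin (fun e => F e - G e) P = lin F P - lin G P.
Proof. by rewrite /lin -sumrB; apply: eq_bigr => e _; rewrite scalerBr. Qed.

Lemma linear_lin V V' (f : {linear V -> V'}) (F : expo -> V) P :
  f (lin F P) = lin (fun e => f (F e)) P.
Proof. by rewrite linear_sum; apply: eq_bigr => e _; rewrite linearZ. Qed.

Lemma scale_lin V z (F : expo -> V) P : z *: lin F P = lin (fun e => z *: F e) P.
Proof.
by rewrite scaler_sumr; apply: eq_bigr => e _; rewrite !scalerA mulrC.
Qed.

Lemma exchange_lin V (F : expo -> expo -> V) P Q :
  lin (fun p => lin (F p) Q) P = lin (fun q => lin (F^~ q) P) Q.
Proof.
rewrite /lin; under eq_bigr do rewrite scaler_sumr.
rewrite exchange_big /=; apply: eq_bigr => q _; rewrite scaler_sumr.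
by apply: eq_bigr => p _; rewrite !scalerA mulrC.
Qed.

Lemma linM (F G : expo -> {poly K}) P Q :
  lin F P * lin G Q = lin (fun p => lin (fun q => F p * G q) Q) P.
Proof.
rewrite /lin big_distrl; apply: eq_bigr => p _ /=.
rewrite big_distrr scaler_sumr; apply: eq_bigr => q _ /=.
by rewrite -scalerAl -scalerAr.
Qed.

Lemma faddE P Q e : fadd P Q e = P e + Q e.
Proof.
rewrite fsfunE inE; case: ifP => // /negbT; rewrite negb_or => /andP[eP eQ].
by rewrite !fsfun_dflt // addr0.
Qed.

Lemma foppE P e : fopp P e = - P e.
Proof. by rewrite fsfunE; case: ifP => // /negbT eP; rewrite fsfun_dflt ?oppr0. Qed.

Lemma fscaleE z P e : fscale z P e = z * P e.
Proof. by rewrite fsfunE; case: ifP => // /negbT eP; rewrite fsfun_dflt ?mulr0. Qed.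

Lemma fzeroE e : fzero K e = 0.
Proof. by rewrite fsfunE. Qed.

Lemma lin_fadd V (F : expo -> V) P Q : lin F (fadd P Q) = lin F P + lin F Q.
Proof.
pose S := (finsupp P `|` finsupp Q)%fset.
rewrite (@lin_widen _ F P S) ?fsubsetUl // (@lin_widen _ F Q S) ?fsubsetUr //.
rewrite (@lin_widen _ F _ S) ?finsupp_sub // -big_split /=.
by apply: eq_bigr => e _; rewrite faddE scalerDl.
Qed.

Lemma lin_fopp V (F : expo -> V) P : lin F (fopp P) = - lin F P.
Proof.
rewrite (@lin_widen _ F _ (finsupp P)) ?finsupp_sub // -sumrN.
by apply: eq_bigr => e _; rewrite foppE scaleNr.
Qed.

Lemma lin_fscale V (F : expo -> V) z P : lin F (fscale z P) = z *: lin F P.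
Proof.
rewrite (@lin_widen _ F _ (finsupp P)) ?finsupp_sub // scaler_sumr.
by apply: eq_bigr => e _; rewrite fscaleE scalerA.
Qed.

Lemma lin_fone V (F : expo -> V) : lin F (fone K) = F (0, 0%N).
Proof.
rewrite (@lin_widen _ F _ [fset (0%Z, 0%N)]%fset) ?finsupp_sub //.
by rewrite big_seq_fset1 fsfunE inE eqxx scale1r.
Qed.

(** Taking a coefficient is itself a linear extension, so the formulas for [lin] on products and
    commutators also yield coefficients. *)
Lemma coef_lin P e : P e = lin (fun e' => (e' == e)%:R : K^o) P.
Proof.
have [eP|eP] := boolP (e \in finsupp P); last first.
  rewrite fsfun_dflt // /lin big_seq big1 // => e' e'P.
  by case: eqP => [ee|_]; rewrite ?scaler0 //; rewrite -ee e'P in eP.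
rewrite /lin (big_fsetD1 _ eP) /= eqxx big_seq big1 ?addr0.
  by rewrite /GRing.scale /= mulr1.
by move=> e'; rewrite !inE => /andP[/negPf -> _]; rewrite scaler0.
Qed.

Variable l : nat.

Definition mulF V (F : expo -> V) (p q : expo) : V :=
  \sum_(t < p.2.+1) mon_coef K l p q t *: F (mon_target l p q t).

Lemma mem_wmul_targets P Q p q (t : nat) :
  p \in finsupp P -> q \in finsupp Q -> (t < p.2.+1)%N ->
  mon_target l p q t \in wmul_targets l P Q.
Proof.
move=> pP qQ tp; apply/flatten_mapP; exists p => //.
apply/flatten_mapP; exists q => //; apply/mapP; exists t => //.
by rewrite mem_iota add0n.
Qed.

Lemma lin_wmul V (F : expo -> V) P Q :
  lin F (wmul l P Q) = lin (fun p => lin (fun q => mulF F p q) Q) P.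
Proof.
pose S := [fset x in wmul_targets l P Q]%fset.
rewrite (@lin_widen _ F _ S) ?finsupp_sub //.
pose c p q t e := if mon_target l p q t == e then P p * Q q * mon_coef K l p q t
                  else 0.
transitivity (\sum_(e <- S) \sum_(p <- finsupp P) \sum_(q <- finsupp Q)
                \sum_(t < p.2.+1) c p q t e *: F e).
  apply: eq_big_seq => e eS; rewrite fsfunE eS.
  rewrite scaler_suml; apply: eq_bigr => p _.
  by rewrite scaler_suml; apply: eq_bigr => q _; rewrite scaler_suml.
rewrite exchange_big; apply: eq_big_seq => p pP /=.
rewrite exchange_big scaler_sumr; apply: eq_big_seq => q qQ /=.
rewrite exchange_big scalerA scaler_sumr; apply: eq_bigr => t _ /=.
have tS : mon_target l p q t \in S by rewrite inE; apply: mem_wmul_targets.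
rewrite (big_fsetD1 _ tS) /= /c eqxx scalerA big_seq big1 ?addr0 //.
by move=> e; rewrite !inE eq_sym => /andP[/negPf -> _]; rewrite scale0r.
Qed.

(** The added terms have ['C(p.2, t) = 0]. The new range is symmetric in [p] and [q], so the two
    products in a commutator can be subtracted term by term. *)
Lemma mulF_widen V (F : expo -> V) p q :
  mulF F p q = \sum_(t < (p.2 + q.2).+1) mon_coef K l p q t *: F (mon_target l p q t).
Proof.
rewrite /mulF -!(big_mkord xpredT (fun t => mon_coef K l p q t *: F (mon_target l p q t))).
rewrite [RHS](@big_cat_nat _ _ _ p.2.+1) //= ?ltnS ?leq_addr //.
rewrite [X in _ = _ + X]big_nat [X in _ = _ + X]big1 ?addr0 // => t /andP[pt _].
by rewrite /mon_coef bin_small // mul0r scale0r.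
Qed.

Lemma mon_targetC p q t : mon_target l p q t = mon_target l q p t.
Proof. by rewrite /mon_target [p.1 + _]addrC addnC. Qed.

(** The terms with [t = 0] form the commutative product and cancel, hence the index [t.+1]. *)
Lemma lin_wcomm V (F : expo -> V) P Q :
  lin F (wcomm l P Q) = lin (fun p => lin (fun q =>
    \sum_(t < p.2 + q.2) (mon_coef K l p q t.+1 - mon_coef K l q p t.+1)
       *: F (mon_target l p q t.+1)) Q) P.
Proof.
rewrite /wcomm lin_fadd lin_fopp !lin_wmul [X in _ - X]exchange_lin -linB.
apply: eq_lin => p _; rewrite -linB; apply: eq_lin => q _.
rewrite !mulF_widen [(q.2 + p.2)%N]addnC -sumrB big_ord_recl /=.
rewrite /mon_coef /ffall !bin0 !big_ord0 mulr1 mon_targetC subrr add0r.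
by apply: eq_bigr => t _; rewrite [mon_target l q p _]mon_targetC -scalerBl.
Qed.

End LinearExtension.

(** * Falling factorials and the Chu-Vandermonde identity *)

Section FallingFactorial.
Variable K : fieldType.
Implicit Types a b : K.

Lemma ffall0 a : ffall a 0 = 1.
Proof. by rewrite /ffall big_ord0. Qed.

Lemma ffallS a t : ffall a t.+1 = ffall a t * (a - t%:R).
Proof. by rewrite /ffall big_ord_recr. Qed.

Lemma ffall_add a k j : ffall a (k + j) = ffall a k * ffall (a - k%:R) j.
Proof.
elim: j => [|j IH]; first by rewrite addn0 ffall0 mulr1.
by rewrite addnS !ffallS IH natrD -mulrA opprD addrA.
Qed.

(** Induction on [j]: write [a + b - j] as [(a - t) + (b - (j - t))] in the [t]-th summand and
    regroup by Pascal's rule. *)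
Lemma ffall_vandermonde a b j :
  ffall (a + b) j = \sum_(t < j.+1) 'C(j, t)%:R * ffall a t * ffall b (j - t).
Proof.
elim: j => [|j IH]; first by rewrite big_ord1 bin0 !ffall0 !mulr1.
rewrite ffallS IH mulr_suml.
transitivity (\sum_(t < j.+1) 'C(j, t)%:R * ffall a t * ffall b (j.+1 - t) +
              \sum_(t < j.+1) 'C(j, t)%:R * ffall a t.+1 * ffall b (j - t)).
  rewrite -big_split; apply: eq_bigr => t _ /=.
  have tj : (t <= j)%N by rewrite -ltnS.
  rewrite subSn // !ffallS natrB //; ring.
rewrite [RHS]big_ord_recl /= [X in X + _ = _]big_ord_recl /= !bin0 -addrA.
congr (_ + _); rewrite [in RHS]big_ord_recr /= [X in _ + X = _]big_ord_recr /=.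
rewrite /bump /= !add1n !subnn !binn !addrA; congr (_ + _).
rewrite -big_split; apply: eq_bigr => t _ /=.
by rewrite /bump /= !add1n subSS binS natrD !mulrDl addrC.
Qed.

Lemma ffall_nat_eq0 (j k : nat) : (j < k)%N -> ffall (j%:R : K) k = 0.
Proof. by move=> jk; rewrite /ffall (bigD1 (Ordinal jk)) //= subrr mul0r. Qed.

Lemma ffall_nat_neq0 (charK : [pchar K] =i pred0) (j : nat) : ffall (j%:R : K) j != 0.
Proof.
rewrite /ffall prodf_seq_neq0; apply/allP => s _ /=.
by rewrite -natrB ?(ltnW (ltn_ord s)) // ((pcharf0P K).1 charK) subn_eq0 -ltnNge.
Qed.

End FallingFactorial.

(** * A faithful representation on Laurent monomials *)

Section Representation.
Variables (K : fieldType) (l : nat).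
Hypotheses (charK : [pchar K] =i pred0) (hl : (0 < l)%N).
Implicit Types (P Q : fam K) (g : int -> K) (s : int).

Definition shift (e : expo) : int := e.1 - (e.2 * l)%:Z.

(* W^(l) acts on K[x^(1/l), x^(-1/l)] by
     X^(i/l) Y^j . x^(s/l) = (s/l)_j x^((s + i - j l)/l).
   This is the transposed right action on functionals [g s = g (x^(s/l))]. *)
Definition act P g s : K :=
  lin (fun e => ffall (s%:~R / l%:R) e.2 * g (s + shift e) : K^o) P.

Let l_neq0 : l%:R != 0 :> K.
Proof. by rewrite ((pcharf0P K).1 charK) -lt0n. Qed.

Lemma eq_act P g g' : g =1 g' -> act P g =1 act P g'.
Proof. by move=> gg s; apply: (@eq_lin _ K^o) => e _; rewrite gg. Qed.

(** The order is reversed because functionals are acted on from the right. On monomials this is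
    Chu-Vandermonde for [q.1 / l] and [s / l - q.2]. *)
Lemma act_wmul P Q g s : act (wmul l P Q) g s = act Q (act P g) s.
Proof.
rewrite /act lin_wmul exchange_lin; apply: (@eq_lin _ K^o) => q _.
rewrite /lin mulr_sumr; apply: eq_bigr => p _.
rewrite /GRing.scale /= mulrCA; congr (_ * _).
have -> : (s + shift q)%:~R / l%:R = q.1%:~R / l%:R + (s%:~R / l%:R - q.2%:R) :> K.
  rewrite /shift !rmorphD rmorphN /= -!pmulrn natrM; field.
  exact: l_neq0.
rewrite ffall_vandermonde mulr_suml mulr_sumr; apply: eq_bigr => t _.
rewrite /mon_coef /mon_target /shift /GRing.scale /=.
have tp : (t <= p.2)%N by rewrite -ltnS.
have -> : (p.2 + q.2 - t = q.2 + (p.2 - t))%N by lia.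
rewrite ffall_add.
have -> : s + (p.1 + q.1 - (t * l)%:Z - ((q.2 + (p.2 - t)) * l)%:Z) =
          s + (q.1 - (q.2 * l)%:Z) + (p.1 - (p.2 * l)%:Z).
  by have := leq_mul tp (leqnn l); rewrite mulnDl mulnBl; lia.
ring.
Qed.

Lemma act_fadd P Q g s : act (fadd P Q) g s = act P g s + act Q g s.
Proof. exact: (@lin_fadd _ K^o). Qed.

Lemma act_fopp P g s : act (fopp P) g s = - act P g s.
Proof. exact: (@lin_fopp _ K^o). Qed.

Lemma act_fscale z P g s : act (fscale z P) g s = z * act P g s.
Proof. exact: (@lin_fscale _ K^o). Qed.

Lemma act_fone g s : act (fone K) g s = g s.
Proof. by rewrite /act lin_fone ffall0 mul1r; congr (g _); rewrite /shift /=; lia. Qed.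

Lemma act_wcomm P Q g s :
  act (wcomm l P Q) g s = act Q (act P g) s - act P (act Q g) s.
Proof. by rewrite act_fadd act_fopp !act_wmul. Qed.

Lemma actB P g g' s : act P (fun x => g x - g' x) s = act P g s - act P g' s.
Proof. by rewrite /act -(@linB _ K^o); apply: (@eq_lin _ K^o) => e _; rewrite mulrBr. Qed.

Lemma actZ P z g s : act P (fun x => z * g x) s = z * act P g s.
Proof.
rewrite /act /lin mulr_sumr; apply: eq_bigr => e _.
by rewrite /GRing.scale /=; ring.
Qed.

(** Induction on the [Y]-exponent [j]. Apply [P] to [x^j] and read off the monomial shifted by [d]:
    terms with smaller [Y]-exponent vanish by induction, those with larger one kill [x^j], and
    [(i, j)] contributes its coefficient times [j!], nonzero in characteristic zero. *)
Lemma act_eq0 P : (forall g s, act P g s = 0) -> forall e, P e = 0.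
Proof.
move=> aP [i j]; elim/ltn_ind: j i => j IH i.
pose d := shift (i, j); pose s : int := (j * l)%:Z.
have := aP (fun x => (x == s + d)%:R) s.
rewrite /act /lin.
under eq_bigr do rewrite (inj_eq (addrI s)).
have -> : s%:~R / l%:R = j%:R :> K by rewrite -pmulrn natrM mulfK ?l_neq0.
have [ijP|ijP _] := boolP ((i, j) \in finsupp P); last by rewrite fsfun_dflt.
rewrite (big_fsetD1 _ ijP) /= eqxx mulr1 big_seq big1 ?addr0.
  by move/eqP; rewrite mulf_eq0 (negPf (ffall_nat_neq0 charK j)) orbF => /eqP.
move=> [i' j']; rewrite !inE => /andP[ne _] /=.
have [dd|_] := eqVneq; last by rewrite mulr0 scaler0.
have [jj|jj|jj] := ltngtP j' j; first by rewrite IH ?scale0r.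
  by rewrite ffall_nat_eq0 // mul0r scaler0.
case/eqP: ne; move: dd; rewrite /d /shift /= jj => /addIr ->.
by [].
Qed.

Lemma act_inj P Q : (forall g s, act P g s = act Q g s) -> P = Q.
Proof.
move=> PQ; apply/fsfunP => e; apply/eqP; rewrite -subr_eq0 -foppE -faddE.
by apply/eqP; apply: act_eq0 => g s; rewrite act_fadd act_fopp PQ subrr.
Qed.

(** Operators compose associatively, so the identity is checked on them and pulled back along the
    faithful action. *)
Lemma wcomm_leibniz A P Q :
  wcomm l A (wmul l P Q) = fadd (wmul l (wcomm l A P) Q) (wmul l P (wcomm l A Q)).
Proof.
apply: act_inj => g s; rewrite act_fadd act_wcomm !act_wmul act_wcomm.
rewrite (eq_act _ (act_wcomm A P g)) actB (eq_act _ (act_wmul P Q g)).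
by rewrite addrA subrK.
Qed.

Lemma wmul_fzero P : wmul l P (fzero K) = fzero K.
Proof.
apply/fsfunP => e; rewrite fzeroE coef_lin lin_wmul /lin big1 // => p _.
by rewrite finsupp0 big_nil scaler0.
Qed.

Lemma wmul_fzerol P : wmul l (fzero K) P = fzero K.
Proof.
by apply/fsfunP => e; rewrite fzeroE coef_lin lin_wmul /lin finsupp0 big_nil.
Qed.

Lemma fadd_fzero P : fadd P (fzero K) = P.
Proof. by apply/fsfunP => e; rewrite faddE fzeroE addr0. Qed.

Lemma wcomm_mulr A P Q :
  wcomm l A Q = fzero K -> wcomm l A (wmul l P Q) = wmul l (wcomm l A P) Q.
Proof. by move=> AQ; rewrite wcomm_leibniz AQ wmul_fzero fadd_fzero. Qed.

Lemma wcomm_self A : wcomm l A A = fzero K.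
Proof. by apply/fsfunP => e; rewrite faddE foppE fzeroE subrr. Qed.

Lemma wcomm_fone A : wcomm l A (fone K) = fzero K.
Proof.
apply/fsfunP => e; rewrite fzeroE; apply: act_eq0 => g s.
by rewrite act_wcomm !act_fone (eq_act _ (act_fone g)) subrr.
Qed.

Lemma wcomm_wexp_self A k : wcomm l A (wexp l A k) = fzero K.
Proof.
elim: k => [|k IH]; first exact: wcomm_fone.
by rewrite [wexp l A k.+1]/= wcomm_mulr // wcomm_self wmul_fzerol.
Qed.

Lemma wcommB A P z Q :
  wcomm l A (fadd P (fopp (fscale z Q))) =
  fadd (wcomm l A P) (fopp (fscale z (wcomm l A Q))).
Proof.
apply: act_inj => g s.
rewrite act_fadd act_fopp act_fscale !act_wcomm act_fadd act_fopp act_fscale.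
have /eq_act -> : act (fadd P (fopp (fscale z Q))) g =1
    fun x => act P g x - z * act Q g x.
  by move=> x; rewrite act_fadd act_fopp act_fscale.
by rewrite actB actZ; ring.
Qed.

Lemma wcommN A P : wcomm l P A = fopp (wcomm l A P).
Proof. by apply/fsfunP => e; rewrite foppE !faddE !foppE opprB. Qed.

End Representation.

(** * Polynomials with vanishing Wronskian in characteristic zero *)

Section Wronskian.
Variables (K : fieldType) (charK : [pchar K] =i pred0).
Implicit Types u w : {poly K}.

Lemma eqr_nat_pchar0 (m n : nat) : (m%:R == n%:R :> K) = (m == n).
Proof.
wlog mn : m n / (m <= n)%N.
  by move=> H; case: (leqP m n) => [/H//|/ltnW /H]; rewrite eq_sym => ->; rewrite eq_sym.
rewrite eq_sym -subr_eq0 -natrB // ((pcharf0P K).1 charK) subn_eq0.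
by rewrite eqn_leq mn.
Qed.

Lemma intr_neq0_pchar0 (x : int) : 0 < x -> x%:~R != 0 :> K.
Proof. by case: x => // x x0; rewrite ((pcharf0P K).1 charK) -lt0n. Qed.

Lemma coefM_top u w a b : (size u <= a.+1)%N -> (size w <= b.+1)%N ->
  (u * w)`_(a + b) = u`_a * w`_b.
Proof.
move=> su sw; have ab : (a < (a + b).+1)%N by rewrite ltnS leq_addr.
rewrite coefM (bigD1 (Ordinal ab)) //= addKn big1 ?addr0 // => i /eqP ia.
have [ai|ai|ai] := ltngtP (i : nat) a; last by case: ia; apply: val_inj.
  by rewrite [w`_ _]nth_default ?mulr0 //; apply: leq_trans sw _; lia.
by rewrite nth_default ?mul0r //; apply: leq_trans su _.
Qed.

Lemma coef_Xderiv u i : ('X * u^`())`_i = u`_i *+ i.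
Proof. by rewrite coefXM; case: i => [|i]; rewrite ?mulr0n // coef_deriv. Qed.

Lemma size_Xderiv u n : (size u <= n)%N -> (size ('X * u^`())%R <= n)%N.
Proof.
move/leq_sizeP => su; apply/leq_sizeP => i ni.
by rewrite coef_Xderiv su // mul0rn.
Qed.

(** After multiplication by ['X], the top coefficients differ by the factor [deg w - deg u], which
    must vanish in [K], hence in the integers. *)
Lemma wronskian0_size u w :
  u != 0 -> w != 0 -> u * w^`() = u^`() * w -> size u = size w.
Proof.
move=> u0 w0 uw; have su : (size u > 0)%N by rewrite size_poly_gt0.
have sw : (size w > 0)%N by rewrite size_poly_gt0.
have /(congr1 (fun p : {poly K} => p`_((size u).-1 + (size w).-1))) :
  u * ('X * w^`()) = 'X * u^`() * w by rewrite mulrCA uw mulrA.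
rewrite !coefM_top ?prednK ?size_Xderiv // !coef_Xderiv mulrnAr mulrnAl.
rewrite -!lead_coefE -mulr_natr -[RHS]mulr_natr => /eqP.
rewrite -subr_eq0 -mulrBr !mulf_eq0 !lead_coef_eq0 (negPf u0) (negPf w0) /=.
rewrite subr_eq0 eqr_nat_pchar0 => /eqP uw1.
by rewrite -(prednK su) -(prednK sw) uw1.
Qed.

(** Subtract from [u] the multiple of [w] that cancels the leading term. The difference still has
    zero Wronskian with [w], so if nonzero it would have the size of [w], which the cancellation
    excludes. *)
Lemma wronskian0_scale u w :
  w != 0 -> u * w^`() = u^`() * w -> exists z, u = z *: w.
Proof.
move=> w0 uw; have [->|u0] := eqVneq u 0; first by exists 0; rewrite scale0r.
have suw := wronskian0_size u0 w0 uw.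
pose z := lead_coef u / lead_coef w; exists z.
apply/eqP; rewrite -subr_eq0; apply/negPn/negP => v0.
have sv : size (u - z *: w) = size w.
  by apply: wronskian0_size => //; rewrite derivB derivZ !mulrBl uw -!scalerAl [w * _]mulrC.
have : lead_coef (u - z *: w) = 0.
  rewrite lead_coefE sv coefB coefZ -lead_coefE -suw -lead_coefE.
  by rewrite divfK ?subrr // lead_coef_eq0.
by move/eqP; rewrite lead_coef_eq0 (negPf v0).
Qed.

(** Multiplied by [r ^+ a.-1 * f ^+ b.-1], the hypothesis says that the Wronskian of [r ^+ a] and
    [f ^+ b] vanishes. *)
Lemma powers_proportional (r f : {poly K}) (a b : nat) : (0 < a)%N -> (0 < b)%N -> f != 0 ->
  b%:R *: (f^`() * r) = a%:R *: (f * r^`()) -> exists z, r ^+ a = z *: f ^+ b.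
Proof.
move=> a0 b0 f0 rf; apply: wronskian0_scale; first exact: expf_neq0.
case: a a0 rf => // a _ rf; case: b b0 rf => // b _ rf.
rewrite !deriv_exp /= !exprS.
transitivity (r ^+ a * f ^+ b * (b.+1%:R *: (f^`() * r))).
  by rewrite scaler_nat; ring.
by rewrite rf scaler_nat; ring.
Qed.

End Wronskian.

Lemma mem_head_seq (T : eqType) (x0 x : T) (s : seq T) : x \in s -> head x0 s \in s.
Proof. by case: s => // y s _; apply: mem_head. Qed.

(** * Leading forms encoded as polynomials in y *)

Section Symbol.
Variables (K : fieldType) (l : nat) (rho sigma : int).
Hypotheses (hl : (0 < l)%N) (rho_gt0 : 0 < rho).
Hypothesis rhosigma_gt0 : 0 < rho + sigma.
Implicit Types (P Q : fam K) (e : expo) (d : int).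

(** This is [l] times [vdeg], rescaled to be an integer. *)
Definition deg e : int := rho * e.1 + sigma * (e.2 * l)%:Z.

Definition comm_drop : int := (rho + sigma) * l%:Z.

Lemma comm_drop_gt0 : 0 < comm_drop.
Proof. by rewrite mulr_gt0. Qed.

Lemma deg_target p q t : (t <= p.2 + q.2)%N ->
  deg (mon_target l p q t) = deg p + deg q - t%:Z * comm_drop.
Proof.
move=> tpq; rewrite /deg /comm_drop /=.
have -> : ((p.2 + q.2 - t) * l)%:Z = ((p.2 * l)%:Z + (q.2 * l)%:Z - t%:Z * l%:Z).
  by rewrite mulnBl -subzn ?leq_mul // mulnDl -PoszM.
by rewrite PoszM; ring.
Qed.

Lemma deg_inj e e' : deg e = deg e' -> e.2 = e'.2 -> e = e'.
Proof.
case: e e' => [i j] [i' j'] + /= jj; rewrite /deg jj => /addIr /= ii.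
by rewrite (mulfI (lt0r_neq0 rho_gt0) ii).
Qed.

Definition hpart_mon d e : {poly K} := if deg e == d then 'X^(e.2) else 0.

Definition hpart d P : {poly K} := lin (hpart_mon d) P.

Lemma coef_hpart d P e : deg e = d -> (hpart d P)`_(e.2) = P e.
Proof.
move=> ed; rewrite [RHS]coef_lin /hpart /lin coef_sum; apply: eq_bigr => e' _.
rewrite coefZ /hpart_mon -ed; congr (_ * _).
have [/eqP dd|dd] := ifPn; last first.
  by rewrite coef0; case: eqP => // ee; rewrite ee eqxx in dd.
rewrite coefXn; have [jj|jj] := eqVneq e.2 e'.2.
  by rewrite (deg_inj dd) ?eqxx.
by case: eqP => // ee; rewrite ee eqxx in jj.
Qed.

Definition bounded d P := forall e, e \in finsupp P -> deg e <= d.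

(** The form [p] may be 0, in which case [d] is only an upper bound; it is the exact degree when
    [p != 0]. Vanishing brackets thus need no separate treatment. *)
Definition sym P d (p : {poly K}) := bounded d P /\ hpart d P = p.

Lemma bounded_fadd d P Q : bounded d P -> bounded d Q -> bounded d (fadd P Q).
Proof.
by move=> bP bQ e /(fsubsetP (finsupp_sub _ _ _)); rewrite inE => /orP[/bP|/bQ].
Qed.

Lemma bounded_fopp d P : bounded d P -> bounded d (fopp P).
Proof. by move=> bP e /(fsubsetP (finsupp_sub _ _ _)) /bP. Qed.

Lemma bounded_fscale d z P : bounded d P -> bounded d (fscale z P).
Proof. by move=> bP e /(fsubsetP (finsupp_sub _ _ _)) /bP. Qed.

Lemma symD d P Q p q : sym P d p -> sym Q d q -> sym (fadd P Q) d (p + q).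
Proof.
move=> [bP <-] [bQ <-]; split; first exact: bounded_fadd.
exact: lin_fadd.
Qed.

Lemma symN d P p : sym P d p -> sym (fopp P) d (- p).
Proof. by move=> [bP <-]; split; [exact: bounded_fopp|exact: lin_fopp]. Qed.

Lemma symZ d z P p : sym P d p -> sym (fscale z P) d (z *: p).
Proof. by move=> [bP <-]; split; [exact: bounded_fscale|exact: lin_fscale]. Qed.

Lemma sym_fzero d : sym (fzero K) d 0.
Proof.
split; first by move=> e; rewrite finsupp0 inE.
by rewrite /hpart /lin finsupp0 big_nil.
Qed.

Lemma sym_fone : sym (fone K) 0 1.
Proof.
split; last by rewrite /hpart lin_fone /hpart_mon /deg /= mulr0 mul0n mulr0 addr0.
move=> e /(fsubsetP (finsupp_sub _ _ _)); rewrite inE => /eqP ->.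
by rewrite /deg /= mulr0 mul0n mulr0 addr0.
Qed.

Lemma sym_lower P d : sym P d 0 -> sym P (d - 1) (hpart (d - 1) P).
Proof.
move=> [bP hP]; split=> // e eP; have := bP e eP.
rewrite le_eqVlt => /orP[/eqP ed|]; last by rewrite lerBrDr lezD1.
have := coef_hpart P ed; rewrite hP coef0 => /esym/eqP Pe.
by move: eP; rewrite mem_finsupp Pe.
Qed.

Lemma sym_raise P d d' p : d < d' -> sym P d p -> sym P d' 0.
Proof.
move=> dd [bP _]; split; first by move=> e /bP ed; apply: le_trans ed (ltW dd).
rewrite /hpart -(lin0 _ P); apply: eq_lin => e /bP ed.
by rewrite /hpart_mon (lt_eqF (le_lt_trans ed dd)).
Qed.

(** The [t]-th term of a product of monomials loses [t * comm_drop] in degree, so only the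
    commutative term [t = 0] reaches [d + d']. *)
Lemma symM d d' P Q p q :
  sym P d p -> sym Q d' q -> sym (wmul l P Q) (d + d') (p * q).
Proof.
move=> [bP <-] [bQ <-]; have dr := comm_drop_gt0; split=> [e|].
  move=> /(fsubsetP (finsupp_sub _ _ _)); rewrite inE => /flatten_mapP[p' pP].
  move=> /flatten_mapP[q' qQ] /mapP[t]; rewrite mem_iota /= ltnS => tp ->.
  have := bP _ pP; have := bQ _ qQ; rewrite deg_target; nia.
rewrite /hpart lin_wmul linM; apply: eq_lin => p' /bP pd; apply: eq_lin => q' /bQ qd.
rewrite /mulF big_ord_recl /= big1 ?addr0 => [|t _].
  rewrite /hpart_mon deg_target // mul0r subr0 /mon_coef bin0 ffall0 mulr1 scale1r.
  rewrite /mon_target /= subn0 exprD.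
  case: (deg p' =P d) => [->|pn].
    by rewrite (inj_eq (addrI d)); case: ifP; rewrite ?mulr0.
  by rewrite mul0r; case: eqP => //; lia.
have tp : (bump 0 t <= p'.2)%N by exact: ltn_ord t.
rewrite /hpart_mon deg_target ?(leq_trans tp) ?leq_addr // /bump /=.
by case: eqP => [|_]; rewrite ?scaler0 //; nia.
Qed.

Lemma symX d P p n : sym P d p -> sym (wexp l P n) (d *+ n) (p ^+ n).
Proof.
move=> sP; elim: n => [|n IH]; first exact: sym_fone.
by rewrite mulrS exprS; apply: symM.
Qed.

Local Notation vval := (vval l rho sigma).
Local Notation vdeg := (vdeg l rho sigma).
Local Notation lead := (lead l rho sigma).

Let l_gt0 : 0 < l%:R :> rat.
Proof. by rewrite ltr0n. Qed.

Lemma vdegE e : vdeg e = (deg e)%:~R / l%:R.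
Proof.
rewrite /Defs.vdeg /deg !PoszM !rmorphD !rmorphM /=; field.
exact: lt0r_neq0.
Qed.

Lemma vdeg_eq e d : (vdeg e == d%:~R / l%:R) = (deg e == d).
Proof.
rewrite vdegE (inj_eq (mulIf _)) ?eqr_int //.
by rewrite invr_eq0 lt0r_neq0.
Qed.

Lemma sym_attained P d p : sym P d p -> p != 0 -> exists2 e, e \in finsupp P & deg e = d.
Proof.
move=> [_ <-] h0; have [/hasP[e eP /eqP ed]|nP] :=
  boolP (has (fun e => deg e == d) (finsupp P)); first by exists e.
case/eqP: h0; rewrite -[RHS](lin0 _ P); apply: eq_lin => e eP.
by rewrite /hpart_mon (negPf (hasPn nP e eP)).
Qed.

Lemma vval_sym P d p : sym P d p -> p != 0 -> vval P = d%:~R / l%:R.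
Proof.
move=> sP p0; have [e eP ed] := sym_attained sP p0.
have le_d e' : e' \in finsupp P -> vdeg e' <= d%:~R / l%:R.
  by move=> /sP.1 ed'; rewrite vdegE ler_pM2r ?invr_gt0 // ler_int.
apply/le_anti/andP; split.
  rewrite /Defs.vval big_seq; apply: bigmax_le => //; apply: le_d.
  exact: mem_head_seq eP.
by rewrite -ed -vdegE; apply: le_bigmax_seq.
Qed.

Lemma leadE P d p e : sym P d p -> p != 0 ->
  lead P e = if deg e == d then p`_(e.2) else 0.
Proof.
move=> sP p0; rewrite fsfunE (vval_sym sP p0) vdeg_eq.
case: ifPn => [_|eP]; case: eqP => // ed.
  by rewrite -sP.2 coef_hpart.
by rewrite -sP.2 coef_hpart // fsfun_dflt.
Qed.

Lemma sym_exists P e0 : P e0 != 0 -> exists d p, p != 0 /\ sym P d p.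
Proof.
rewrite -mem_finsupp => e0P.
have [e eP emax] : exists2 e, e \in finsupp P & forall e', e' \in finsupp P -> deg e' <= deg e.
  (* The default value in [vval] is the degree of the head of the support, so the maximum is
     attained on the support. *)
  have : vval P \in map vdeg (finsupp P).
    rewrite /Defs.vval big_seq; elim/big_ind: _ => [|x y xP yP|e eP].
    - by apply: map_f; exact: mem_head_seq e0P.
    - by rewrite /Num.max; case: ifP.
    - exact: map_f.
  case/mapP => e eP vE; exists e => // e' e'P.
  have : vdeg e' <= vval P by apply: le_bigmax_seq.
  by rewrite vE !vdegE ler_pM2r ?invr_gt0 // ler_int.
exists (deg e), (hpart (deg e) P); split; last by split.
apply: contraTneq eP => h0; rewrite mem_finsupp -(coef_hpart P (erefl (deg e))).
by rewrite h0 coef0 eqxx.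
Qed.

Lemma hpart_ext d P Q : (forall e, deg e = d -> P e = Q e) -> hpart d P = hpart d Q.
Proof.
move=> PQ; apply/eqP; rewrite -subr_eq0 /hpart -lin_fopp -lin_fadd.
rewrite -[X in _ == X](lin0 _ (fadd P (fopp Q))); apply/eqP; apply: eq_lin => e.
rewrite mem_finsupp faddE foppE subr_eq0 /hpart_mon.
by case: (deg e =P d) => // /PQ ->; rewrite eqxx.
Qed.

Lemma lead_sym P Q d q z : z != 0 -> q != 0 -> sym P d (z *: q) -> sym Q d q ->
  lead P = fscale z (lead Q).
Proof.
move=> z0 q0 sP sQ; have zq0 : z *: q != 0 by rewrite scaler_eq0 negb_or z0.
apply/fsfunP => e; rewrite fscaleE (leadE _ sP) // (leadE _ sQ) //.
by case: ifP; rewrite ?coefZ ?mulr0.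
Qed.

(** A monomial of degree [d] in the support of [Q] survives in [lead P]; this forces [P] to be
    nonzero of degree exactly [d], and coefficients can be compared there. *)
Lemma sym_lead P Q d q z : z != 0 -> q != 0 -> sym Q d q ->
  lead P = fscale z (lead Q) -> sym P d (z *: q).
Proof.
move=> z0 q0 sQ lPQ; have [e eQ ed] := sym_attained sQ q0.
have lPe : lead P e != 0.
  rewrite lPQ fscaleE (leadE _ sQ) // ed eqxx -sQ.2 coef_hpart //.
  by rewrite mulf_neq0 // -mem_finsupp.
have Pe : P e != 0.
  by move: lPe; rewrite fsfunE; case: ifP; rewrite ?eqxx // mem_finsupp.
have [d' [p [p0 sP]]] := sym_exists Pe.
have dd : d' = d by move: lPe; rewrite (leadE _ sP) // ed; case: (d =P d') => [->|]; rewrite ?eqxx.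
rewrite {d'}dd in sP; suff <- : p = z *: q by [].
rewrite -sP.2 -sQ.2 -[RHS](lin_fscale _ z Q); apply: hpart_ext => e' e'd.
move/fsfunP/(_ e'): lPQ; rewrite !fscaleE (leadE _ sP) // (leadE _ sQ) // e'd eqxx.
by rewrite -sP.2 -sQ.2 !coef_hpart.
Qed.

(* The Poisson bracket {p, q} of quasi-homogeneous forms of (scaled) degrees
   d and d', dehomogenised at x = 1: Euler's identity
   d p = l rho x p_x + l sigma y p_y eliminates the x-derivatives. *)
Definition poisson d d' (p q : {poly K}) : {poly K} :=
  (rho%:~R * l%:R)^-1 *: (d'%:~R *: (p^`() * q) - d%:~R *: (p * q^`())).

Hypothesis charK : [pchar K] =i pred0.

Let l_neq0 : l%:R != 0 :> K.
Proof. by rewrite ((pcharf0P K).1 charK) -lt0n. Qed.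

Lemma sym_wcomm d d' P Q p q :
  sym P d p -> sym Q d' q -> sym (wcomm l P Q) (d + d' - comm_drop) (poisson d d' p q).
Proof.
move=> [bP <-] [bQ <-]; have dr := comm_drop_gt0; split=> [e|].
  rewrite mem_finsupp; apply: contraNT; rewrite -ltNge => ed.
  rewrite coef_lin lin_wcomm; apply/eqP.
  rewrite -[RHS](@lin0 _ K^o P); apply: (@eq_lin _ K^o) => p' /bP pd.
  rewrite -[RHS](@lin0 _ K^o Q); apply: (@eq_lin _ K^o) => q' /bQ qd.
  rewrite big1 // => t _; case: eqP => [te|_]; last by rewrite scaler0.
  by move: ed; rewrite -te deg_target //; nia.
have derivE d0 P0 : (hpart d0 P0)^`() = lin (fun e => (hpart_mon d0 e)^`()) P0.
  exact: linear_lin.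
rewrite /poisson !derivE {1}/hpart lin_wcomm !linM !scale_lin.
rewrite -linB scale_lin; apply: eq_lin => p' /bP pd.
rewrite !scale_lin -linB scale_lin; apply: eq_lin => q' /bQ qd.
(* A term reaches the top degree only if it is the first one and both monomials have the maximal
   degrees. *)
have termN0 t : (t < p'.2 + q'.2)%N -> (0 < t)%N \/ ~~ ((deg p' == d) && (deg q' == d')) ->
    hpart_mon (d + d' - comm_drop) (mon_target l p' q' t.+1) = 0.
  move=> tpq t0; rewrite /hpart_mon deg_target //.
  case: eqP => // tE; case: t0 => [t0|/negP[]]; first by nia.
  by apply/andP; split; apply/eqP; nia.
have [/andP[/eqP pd' /eqP qd']|npq] := boolP ((deg p' == d) && (deg q' == d')); last first.
  rewrite big1 => [|t _]; last by rewrite termN0 ?scaler0 //; right.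
  move: npq; rewrite /hpart_mon negb_and => /orP[] /negPf ->;
    by rewrite deriv0 ?mul0r ?mulr0 !scaler0 subrr scaler0.
rewrite /hpart_mon pd' qd' !eqxx !derivXn.
have mulX (a b : nat) : 'X^(a.-1) *+ a * 'X^b = a%:R *: 'X^((a + b).-1) :> {poly K}.
  by case: a => [|a]; rewrite ?mulr0n ?mul0r ?scale0r // mulrnAl -exprD scaler_nat.
rewrite ['X^(p'.2) * _]mulrC !mulX [(q'.2 + p'.2)%N]addnC !scalerA -scalerBl scalerA.
move: termN0; case pqE: (p'.2 + q'.2)%N => [|k] termN0.
  have [-> ->] : p'.2 = 0%N /\ q'.2 = 0%N by lia.
  by rewrite big_ord0 !mulr0 subrr mulr0 scale0r.
rewrite big_ord_recl big1 => [|t _]; last first.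
  by rewrite [X in _ *: X]termN0 ?scaler0 //; left.
rewrite addr0 /= deg_target ?pqE // pd' qd' mul1r eqxx /mon_target ?pqE ?subn1 /=.
(* With [p' = (i, j)] and [q' = (i', j')] the coefficient is [(j i' - j' i) / l], and
   [d' j - d j' = rho (j i' - j' i)] because the [sigma] parts cancel. *)
congr (_ *: _); rewrite /mon_coef !bin1 !ffallS !ffall0 !mul1r !subr0 -pd' -qd' /deg.
rewrite !PoszM !rmorphD !rmorphM /=; field.
by rewrite intr_neq0_pchar0 ?l_neq0.
Qed.

End Symbol.

(** * Descent on the gap between the bound for the commutator degree and its actual value *)

Section Descent.
Variables (K : fieldType) (l : nat) (rho sigma : int).
Hypotheses (charK : [pchar K] =i pred0) (hl : (0 < l)%N) (rho_gt0 : 0 < rho).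
Hypothesis rhosigma_gt0 : 0 < rho + sigma.
Local Notation sym := (sym l rho sigma).
Local Notation comm_drop := (comm_drop l rho sigma).
Local Notation symM := (symM hl rho_gt0 rhosigma_gt0).
Local Notation symX := (symX hl rho_gt0 rhosigma_gt0).

(** The Leibniz rule gives the derivative of a power: [R] and [[A, R]] need not commute, but their
    leading forms do. *)
Lemma sym_wcomm_wexp (A R : fam K) d r e f k :
  sym R d r -> sym (wcomm l A R) e f ->
  sym (wcomm l A (wexp l R k.+1)) (d *+ k + e) (k.+1%:R *: (r ^+ k * f)).
Proof.
move=> sR sAR; elim: k => [|k IH].
  rewrite [wexp l R 1]/= wcomm_mulr ?wcomm_fone //.
  have := symM sAR (sym_fone _ _ _ _).
  by rewrite mulr0n add0r expr0 mul1r scale1r mulr1 addr0.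
rewrite [wexp l R k.+2]/= wcomm_leibniz //.
have := symM sAR (symX k.+1 sR); rewrite addrC => s1.
have := symM sR IH; rewrite addrA -mulrS => s2.
have := symD s1 s2; congr (sym _ _ _).
by rewrite !scaler_nat !exprS; ring.
Qed.

Variables (A : fam K) (c : {poly K}) (dc : int) (n : nat).
Hypotheses (c_neq0 : c != 0) (dc_gt0 : 0 < dc) (n_gt0 : (0 < n)%N).
Hypothesis sA : sym A (dc *+ n) (c ^+ n).

(** Since [A] commutes with its powers, multiplying [R] by them raises both degrees equally and
    leaves the gap unchanged. *)
Lemma sym_wcomm_mul_wexp R d r h (lam : K) s :
  sym R d r -> sym (wcomm l A R) (dc *+ h) (lam *: c ^+ h) ->
  sym (wmul l R (wexp l A s)) (d + dc *+ (n * s)) (r * c ^+ (n * s)) /\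
  sym (wcomm l A (wmul l R (wexp l A s))) (dc *+ (h + n * s)) (lam *: c ^+ (h + n * s)).
Proof.
move=> sR sAR; have := symX s sA; rewrite -mulrnA -exprM => sAs.
split; first exact: symM.
rewrite wcomm_mulr ?wcomm_wexp_self // mulrnDr exprD scalerAl.
exact: symM.
Qed.

(** The last equation says that [[A, R]] attains the generic degree bound, so its leading form is
    the Poisson bracket of the leading forms. *)
Definition tight R d r h (lam : K) := [/\ lam != 0, sym R d r,
  sym (wcomm l A R) (dc *+ h) (lam *: c ^+ h) & dc *+ h = d + dc *+ n - comm_drop].

(** Induction on the gap [k]. As [d] only bounds the degree of [R], each step lowers the gap by
    exactly one, even if the true degree falls further. *)
Lemma tight_exists k R d r h (lam : K) :
  lam != 0 -> sym R d r -> sym (wcomm l A R) (dc *+ h) (lam *: c ^+ h) ->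
  d + dc *+ n - comm_drop - dc *+ h = k%:Z ->
  exists R' d' r' h' lam', tight R' d' r' h' lam'.
Proof.
elim: k R d r h lam => [|k IH] R d r h lam lam0 sR sAR gap.
  by exists R, d, r, h, lam; split=> //; lia.
(* The exponent [|d| + 1] suffices because [A] has degree at least 1. *)
wlog d_gt0 : R d r h sR sAR gap / 0 < d.
  move=> H; have [sR' sAR'] := sym_wcomm_mul_wexp `|d|.+1 sR sAR.
  apply: H sR' sAR' _ _; first by rewrite mulrnDr -gap; ring.
  have : 1 <= dc *+ n by rewrite -mulr_natr; nia.
  by rewrite mulrnA -[_ *+ `|d|.+1]mulr_natr natz; nia.
have [r0|r0] := eqVneq r 0.
  by rewrite r0 in sR; apply: (IH _ _ _ _ _ lam0 (sym_lower rho_gt0 sR) sAR); lia.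
have f0 : c ^+ n != 0 by apply: expf_neq0.
have a_gt0 : 0 < dc *+ n by rewrite pmulrn_lgt0.
have [a' aE] : exists a', dc *+ n = a'.+1%:Z by exists `|dc *+ n|.-1; lia.
have [b bE] : exists b, d = b%:Z by exists `|d|%N; lia.
have b_gt0 : (0 < b)%N by lia.
(* The gap is positive, so [[A, R]] has no component in the degree of the Poisson bracket. *)
have pb0 : poisson l rho (dc *+ n) d (c ^+ n) r = 0.
  have := (sym_wcomm hl rho_gt0 rhosigma_gt0 charK sA sR).2.
  have /sym_raise := sAR; move/(_ (dc *+ n + d - comm_drop)) => [|_ ->] //.
  by lia.
have [z zE] : exists z, r ^+ a'.+1 = z *: (c ^+ n) ^+ b.
  apply: (powers_proportional charK) => //.
  move/eqP: pb0; rewrite scaler_eq0 invr_eq0 mulf_eq0 => /orP[/orP[]|].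
  - by rewrite (negPf (intr_neq0_pchar0 charK rho_gt0)).
  - by rewrite ((pcharf0P K).1 charK); lia.
  - by rewrite subr_eq0 aE bE -!pmulrn => /eqP.
have z0 : z != 0.
  by apply: contraNneq (expf_neq0 a'.+1 r0) => z0; rewrite zE z0 scale0r.
(* Both powers have degree [d * a = dc * n * b] and equal leading forms up to [z], so the top part
   cancels, while [[A, R1] = [A, R^a]]. *)
pose R1 := fadd (wexp l R a'.+1) (fopp (fscale z (wexp l A b))).
have ab : d *+ a'.+1 = dc *+ n *+ b.
  by rewrite -mulr_natr -[RHS]mulr_natr aE bE !natz mulrC.
have sR1 : sym R1 (d *+ a'.+1) 0.
  rewrite -(subrr (r ^+ a'.+1)); apply: symD; first exact: symX.
  by rewrite ab zE; apply/symN/symZ/symX.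
have sAR1 : sym (wcomm l A R1) (d *+ a' + dc *+ h) (a'.+1%:R *: (r ^+ a' * (lam *: c ^+ h))).
  rewrite wcommB // wcomm_wexp_self //.
  have := symD (sym_wcomm_wexp a' sR sAR) (symN (symZ z (sym_fzero _ _ _ _ _))).
  by rewrite scaler0 subr0.
(* The extra factor [R] turns [r ^+ a'] in the leading form of [[A, R1]] into [r ^+ a'.+1], which is
   [z] times a power of [c]. The other Leibniz term, [R1 [A, R]], contributes 0 in this degree. *)
have sR2 := symM (sym_lower rho_gt0 sR1) sR.
have sAR2 : sym (wcomm l A (wmul l R1 R)) (dc *+ (n * b + h))
    ((a'.+1%:R * lam * z) *: c ^+ (n * b + h)).
  rewrite wcomm_leibniz //.
  have := symM sAR1 sR; have := symM sR1 sAR.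
  have -> : d *+ a' + dc *+ h + d = dc *+ (n * b + h).
    by rewrite mulrnDr mulrnA -ab mulrS; ring.
  have -> : d *+ a'.+1 + dc *+ h = dc *+ (n * b + h).
    by rewrite mulrnDr mulrnA -ab.
  move=> s1 s2; have := symD s2 s1; congr (sym _ _ _).
  rewrite mul0r addr0 exprD exprM -!scalerA.
  rewrite [z *: _]scalerAl -zE exprS -scalerAl; congr (_ *: _).
  by rewrite -scalerAr -scalerAl; congr (_ *: _); ring.
apply: (IH _ _ _ _ _ _ sR2 sAR2).
  by rewrite !mulf_neq0 // ((pcharf0P K).1 charK).
have -> : dc *+ (n * b + h) = d *+ a'.+1 + dc *+ h by rewrite mulrnDr mulrnA -ab.
by lia.
Qed.

End Descent.

(** * Starting the descent at [B] and reading off the bracket with a power of [C] *)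

Theorem theorem3p1 (K : fieldType) (charK : [pchar K] =i pred0)
  (l : nat) (hl : (0 < l)%N) (rho sigma : int) (hV : in_frakV rho sigma)
  (hsigma : sigma <= 0) (C : fam K)
  (hvC : 0 < vval l rho sigma C)
  (hnotpow : forall (D : fam K) (zeta : K) (h : nat), zeta != 0 -> (1 < h)%N ->
      lead l rho sigma C <> fscale zeta (lead l rho sigma (wexp l D h)))
  (n m : nat) (A B : fam K) (hn : (0 < n)%N) (hm : (0 < m)%N)
  (h1 : lead l rho sigma A = lead l rho sigma (wexp l C n))
  (h2 : lead l rho sigma B = lead l rho sigma (wexp l C m))
  (h3 : gcdn n m \notin [:: n; m])
  (h4 : exists (h : nat) (lam : K), lam != 0 /\
      lead l rho sigma (wcomm l A B) = fscale lam (lead l rho sigma (wexp l C h))) :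
  exists (D : fam K) (mu : K) (k j0 : nat),
    [/\ mu != 0, (0 < k)%N, (0 < j0)%N &
     brk l rho sigma D (wexp l C k) = fscale mu (lead l rho sigma (wexp l C (k + j0)))].
Proof.
have [_ rs_gt0] := hV; have rho_gt0 : 0 < rho by lia.
have l_gt0 : 0 < l%:R :> rat by rewrite ltr0n.
(* For [C = 0] the default in [vval] is the degree of the exponent [(0, 0)], that is 0, against
   [hvC]. *)
have [e0 Ce0] : exists e, C e != 0.
  have [C0|[e]] := fset_0Vmem (finsupp C); last by rewrite mem_finsupp; exists e.
  by move: hvC; rewrite /vval C0 big_nil /vdeg /= mul0r !mulr0 addr0 ltxx.
have [dc [c [c0 sC]]] := sym_exists sigma hl rho_gt0 Ce0.
have dc_gt0 : 0 < dc.
  by move: hvC; rewrite (vval_sym hl sC c0) pmulr_lgt0 ?invr_gt0 // ltr0z.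
have cX k : c ^+ k != 0 by apply: expf_neq0.
have sCX k := symX hl rho_gt0 rs_gt0 k sC.
have fscale1 (P : fam K) : fscale 1 P = P.
  by apply/fsfunP => e; rewrite fscaleE mul1r.
have sLead P k : lead l rho sigma P = lead l rho sigma (wexp l C k) ->
    sym l rho sigma P (dc *+ k) (c ^+ k).
  rewrite -[RHS]fscale1 => /(sym_lead hl rho_gt0 (oner_neq0 K) (cX k) (sCX k)).
  by rewrite scale1r.
have sA := sLead _ _ h1; have sB := sLead _ _ h2.
have [h [lam [lam0 /(sym_lead hl rho_gt0 lam0 (cX h) (sCX h)) sAB]]] := h4.
(* Were the gap negative, [[A, B]] would have no component in degree [dc *+ h], where it has
   [lam *: c ^+ h]. *)
have [k gap] : exists k : nat, dc *+ m + dc *+ n - comm_drop l rho sigma - dc *+ h = k%:Z.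
  have [gap|neg] := leP (dc *+ h) (dc *+ n + dc *+ m - comm_drop l rho sigma).
    by exists `|(dc *+ m + dc *+ n - comm_drop l rho sigma - dc *+ h)%R|%N; lia.
  have := (sym_raise neg (sym_wcomm hl rho_gt0 rs_gt0 charK sA sB)).2.
  rewrite sAB.2 => /eqP; rewrite scaler_eq0 (negPf lam0) /=.
  by rewrite (negPf (cX h)).
have [R [d [r [h' [lam' [lam'0 sR sAR tight]]]]]] :=
  tight_exists charK hl rho_gt0 rs_gt0 c0 dc_gt0 hn sA lam0 sB sAB gap.
(* The square of [A] raises the exponent to [h' + 2n], which exceeds [k = n] by
   [j0 = h' + n > 0]. *)
have [sD sAD] := sym_wcomm_mul_wexp charK hl rho_gt0 rs_gt0 sA 2 sR sAR.
set D := wmul l R _ in sD sAD; set dD := d + _ in sD; set rD := r * _ in sD.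
have sDA := sym_wcomm hl rho_gt0 rs_gt0 charK sD sA.
have sDC := sym_wcomm hl rho_gt0 rs_gt0 charK sD (sCX n).
have degE : dD + dc *+ n - comm_drop l rho sigma = dc *+ (h' + n * 2).
  by rewrite /dD mulrnDr tight; ring.
have mu0 : - lam' != 0 by rewrite oppr_eq0.
(* The Poisson bracket sees only leading forms, and [A] and [C^n] share theirs, so it can be
   computed from [[D, A] = - [A, D]]. *)
have poissonE : poisson l rho dD (dc *+ n) rD (c ^+ n) = - lam' *: c ^+ (h' + n * 2).
  by rewrite -sDA.2 degE wcommN scaleNr; exact: (symN sAD).2.
rewrite poissonE degE in sDC.
have comm0 : - lam' *: c ^+ (h' + n * 2) != 0 by rewrite scaler_eq0 (negPf mu0) /= cX.
have rD0 : rD != 0.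
  apply: contra_neq comm0 => rD0.
  by rewrite -poissonE /poisson rD0 deriv0 !mul0r !scaler0 subrr scaler0.
exists D, (- lam'), n, (h' + n)%N; split=> //; first by lia.
have -> : (n + (h' + n) = h' + n * 2)%N by lia.
rewrite /brk; case: eqP => [D0|_].
  by move: comm0; rewrite -sDC.2 D0 (sym_fzero K l rho sigma _).2 eqxx.
rewrite (vval_sym hl sDC comm0) (vval_sym hl sD rD0) (vval_sym hl (sCX n) (cX n)).
(* Tightness makes the two sides of the comparison in [brk] equal, so the nonzero branch is
   taken. *)
have -> : dD%:~R / l%:R + (dc *+ n)%:~R / l%:R - (rho + sigma)%:~R =
          (dc *+ (h' + n * 2))%:~R / l%:R :> rat.
  rewrite -degE /comm_drop !rmorphB !rmorphD !rmorphM /=; field.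
  exact: lt0r_neq0.
rewrite ltxx; exact: lead_sym sDC (sCX _).
Qed.
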